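(* The nested sequent calculi $\mathsf{ND}$ (for modal logic $\mathsf{D}$) and $\mathsf{NT}$ (for modal logic $\mathsf{T}$) have the bisimulation nested-sequent uniform interpolation property (BNUIP).
   Context: Modal formulas are in negation normal form built from $\bot,\top,p,\overline p$ with $\land,\lor,\Box,\Diamond$. A nested sequent has the form $\varphi_1,\dots,\varphi_n,[\Gamma_1],\dots,[\Gamma_m]$; its nodes are labelled by finite sequences of naturals (root $1$, the $i$-th box inside node $\sigma$ is $\sigma*i$), $\mathcal{L}(\Gamma)$ is the set of labels and $\sigma:\varphi\in\Gamma$ means $\varphi$ occurs at node $\sigma$. $\mathsf{NK}$ is Brünnler's terminating nested calculus for $\mathsf{K}$ (rules $\mathsf{id_P},\mathsf{id_\top},\lor,\land,\Box,\mathsf{k}$); $\mathsf{ND}$ adds rule $\mathsf{d}$ (from $\Gamma\{\Diamond\varphi,[\varphi]\}$ infer $\Gamma\{\Diamond\varphi\}$) and $\mathsf{NT}$ adds rule $\mathsf{t}$ (from $\Gamma\{\Diamond\varphi,\varphi\}$ infer $\Gamma\{\Diamond\varphi\}$); they are sound and complete for $\mathsf{D}=\mathsf{K}+\Box\varphi\to\Diamond\varphi$ and $\mathsf{T}=\mathsf{K}+\Box\varphi\to\varphi$. $\mathsf{D}$-models are finite intransitive directed trees with serial accessibility (so leaves are reflexive, other nodes irreflexive); $\mathsf{T}$-models are finite intransitive trees with reflexive accessibility. A multiworld interpretation of $\Gamma$ into $\mathcal{M}=(W,R,V)$ is $\mathcal{I}:\mathcal{L}(\Gamma)\to W$ with $\mathcal{I}(\sigma)R\,\mathcal{I}(\sigma*n)$;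 $\mathcal{M},\mathcal{I}\models\Gamma$ iff $\mathcal{M},\mathcal{I}(\sigma)\models\varphi$ for some $\sigma:\varphi\in\Gamma$. Multiformulas: $\mho ::= \sigma:\varphi\mid(\mho\curlywedge\mho)\mid(\mho\curlyvee\mho)$, with $\curlywedge$ (multiformula conjunction) and $\curlyvee$ (multiformula disjunction) interpreted classically and $\mathcal{M},\mathcal{I}\models\sigma:\varphi$ iff $\mathcal{M},\mathcal{I}(\sigma)\models\varphi$. $(\mathcal{M},\mathcal{I})\sim_p(\mathcal{M}',\mathcal{I}')$ means there is a bisimulation up to $p$ (agreement on all atoms other than $p$, plus forth and back) relating $\mathcal{I}(\sigma)$ and $\mathcal{I}'(\sigma)$ for all labels $\sigma$. A nested calculus $\mathsf{NL}$ for logic $\mathsf{L}$ has the BNUIP if for each nested sequent $\Gamma$ and atom $p$ there is a multiformula $A_p(\Gamma)$ such that: (i) $\mathit{Var}(A_p(\Gamma))\subseteq\mathit{Var}(\Gamma)\setminus\{p\}$ and $\mathcal{L}(A_p(\Gamma))\subseteq\mathcal{L}(\Gamma)$; (ii) for every multiworld interpretation $\mathcal{I}$ of $\Gamma$ into an $\mathsf{L}$-model $\mathcal{M}$, $\mathcal{M},\mathcal{I}\models A_p(\Gamma)$ implies $\mathcal{M},\mathcal{I}\models\Gamma$; (iii)$'$ if $\mathcal{M},\mathcal{I}\not\models A_p(\Gamma)$ for an $\mathsf{L}$-model $\mathcal{M}$, then there are an $\mathsf{L}$-model $\mathcal{M}'$ and a multiworld interpretation $\mathcal{I}'$ of $\Gamma$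 into $\mathcal{M}'$ with $(\mathcal{M}',\mathcal{I}')\sim_p(\mathcal{M},\mathcal{I})$ and $\mathcal{M}',\mathcal{I}'\not\models\Gamma$. *)

(* Defs.v *)
From HB Require Import structures.
From mathcomp Require Import all_boot.

Set Implicit Arguments.
Unset Strict Implicit.
Unset Printing Implicit Defensive.

Definition atom := nat.

Inductive form : Type :=
| Bot
| Top
| Pos of atom
| Neg of atom
| And of form & form
| Or of form & form
| Box of form
| Dia of form.

Lemma form_comparable : comparable form.
Proof. by move=> x y; rewrite /decidable; do !decide equality. Defined.

HB.instance Definition _ := hasDecEq.Build form (compareP form_comparable).

Fixpoint form_vars (f : form) : seq atom :=
  match f with
  | Bot | Top => [::]
  | Pos q | Neg q => [:: q]
  | And g h | Or g h => form_vars g ++ form_vars h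
  | Box g | Dia g => form_vars g
  end.

(* A node carries its formulas f_1, ..., f_n and its boxes [G_1], ..., [G_m].
   Boxes are kept in a list because their position determines their label. *)
Inductive nseq : Type := NSeq of seq form & seq nseq.

Definition formulas (G : nseq) : seq form := let: NSeq fs _ := G in fs.
Definition boxes (G : nseq) : seq nseq := let: NSeq _ bs := G in bs.

Fixpoint nseq_vars (G : nseq) : seq atom :=
  let: NSeq fs bs := G in
  flatten (map form_vars fs) ++ flatten (map nseq_vars bs).

(* Labels are read from the root down: the root is [:: 1], and the i-th box
   (counted from 1) inside the node s is rcons s i. *)
Definition label := seq nat.

Fixpoint sub_at (G : nseq) (s : seq nat) : option nseq :=
  match s with
  | [::] => Some G
  | 0 :: _ => None
  | i.+1 :: s' => if onth (boxes G) i is Some D then sub_at D s' else None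
  end.

Definition node_at (G : nseq) (s : label) : option nseq :=
  if s is 1 :: s' then sub_at G s' else None.

Definition has_label (G : nseq) (s : label) : bool := isSome (node_at G s).

Definition occurs (G : nseq) (s : label) (f : form) : bool :=
  if node_at G s is Some D then f \in formulas D else false.

Fixpoint insert_at (s : seq nat) (D G : nseq) : nseq :=
  match s with
  | [::] => NSeq (formulas G ++ formulas D) (boxes G ++ boxes D)
  | 0 :: _ => G
  | i.+1 :: s' =>
      if onth (boxes G) i is Some G'
      then NSeq (formulas G) (set_nth G' (boxes G) i (insert_at s' D G'))
      else G
  end.

(* If G is a filled context G{f} whose hole lies at the node s, then
   extend G s D is G{f, D}. *)
Definition extend (G : nseq) (s : label) (D : nseq) : nseq :=
  if s is 1 :: s' then insert_at s' D G else G.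

(* The rules of NK, together with the one-premise rules of ext
   (ext D G: from the premise D infer the conclusion G).  Each rule is read
   as Γ{f} with the hole at the node s; principal formulas are selected by
   membership, so the order of the formulas in a node is immaterial. *)
Inductive NK_with (ext : nseq -> nseq -> Prop) : nseq -> Prop :=
| NK_idP G s q :
    occurs G s (Pos q) -> occurs G s (Neg q) -> NK_with ext G
| NK_idT G s :
    occurs G s Top -> NK_with ext G
| NK_or G s f g :
    occurs G s (Or f g) ->
    NK_with ext (extend G s (NSeq [:: f; g] [::])) -> NK_with ext G
| NK_and G s f g :
    occurs G s (And f g) ->
    NK_with ext (extend G s (NSeq [:: f] [::])) ->
    NK_with ext (extend G s (NSeq [:: g] [::])) -> NK_with ext G
| NK_box G s f :
    occurs G s (Box f) ->
    NK_with ext (extend G s (NSeq [::] [:: NSeq [:: f] [::]])) ->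
    NK_with ext G
| NK_k G s n f :
    occurs G s (Dia f) -> has_label G (rcons s n) ->
    NK_with ext (extend G (rcons s n) (NSeq [:: f] [::])) -> NK_with ext G
| NK_ext D G :
    ext D G -> NK_with ext D -> NK_with ext G.

Inductive rule_d : nseq -> nseq -> Prop :=
| RuleD G s f : occurs G s (Dia f) ->
    rule_d (extend G s (NSeq [::] [:: NSeq [:: f] [::]])) G.

Inductive rule_t : nseq -> nseq -> Prop :=
| RuleT G s f : occurs G s (Dia f) ->
    rule_t (extend G s (NSeq [:: f] [::])) G.

Record model : Type := Model {
  world : finType;
  acc : rel world;
  valuation : atom -> pred world
}.

Fixpoint sat (M : model) (w : world M) (f : form) : bool :=
  match f with
  | Bot => false
  | Top => true
  | Pos q => valuation q w
  | Neg q => ~~ valuation q w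
  | And g h => sat w g && sat w h
  | Or g h => sat w g || sat w h
  | Box g => [forall v, acc w v ==> sat v g]
  | Dia g => [exists v, acc w v && sat v g]
  end.

(* There is a root from which every vertex is reached by exactly one walk;
   such a relation is irreflexive, acyclic and intransitive. *)
Definition directed_tree (T : finType) (e : rel T) : Prop :=
  exists r : T, forall x : T, exists! s : seq T, path e r s /\ last r s = x.

Definition strict (T : finType) (e : rel T) : rel T :=
  [rel x y | (x != y) && e x y].

(* Seriality forces the leaves of the tree to be reflexive; the last clause
   says that no other world is. *)
Definition D_model (M : model) : Prop :=
  [/\ directed_tree (strict (@acc M)),
      forall w : world M, exists v : world M, acc w v
    & forall w v : world M, strict (@acc M) w v -> ~~ acc w w].

Definition T_model (M : model) : Prop :=
  directed_tree (strict (@acc M)) /\ reflexive (@acc M).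

(* Interpretations are total functions on labels, but only their values on
   the labels of the sequent are ever constrained or used. *)
Definition interpretation (G : nseq) (M : model) (I : label -> world M) : Prop :=
  forall (s : label) (n : nat),
    has_label G (rcons s n) -> has_label G s -> acc (I s) (I (rcons s n)).

Definition nseq_sat (M : model) (I : label -> world M) (G : nseq) : Prop :=
  exists (s : label) (f : form), occurs G s f /\ sat (I s) f.

Inductive mform : Type :=
| MAt of label & form
| MAnd of mform & mform
| MOr of mform & mform.

Fixpoint mform_vars (A : mform) : seq atom :=
  match A with
  | MAt _ f => form_vars f
  | MAnd B C | MOr B C => mform_vars B ++ mform_vars C
  end.

Fixpoint mform_labels (A : mform) : seq label :=
  match A with
  | MAt s _ => [:: s]
  | MAnd B C | MOr B C => mform_labels B ++ mform_labels C
  end.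

Fixpoint mform_sat (M : model) (I : label -> world M) (A : mform) : bool :=
  match A with
  | MAt s f => sat (I s) f
  | MAnd B C => mform_sat I B && mform_sat I C
  | MOr B C => mform_sat I B || mform_sat I C
  end.

Definition bisimulation_up_to (p : atom) (M M' : model)
    (Z : world M -> world M' -> Prop) : Prop :=
  (exists w w', Z w w') /\
  forall w w', Z w w' ->
    [/\ forall q, q <> p -> valuation q w = valuation q w',
        forall v, acc w v -> exists v', acc w' v' /\ Z v v'
      & forall v', acc w' v' -> exists v, acc w v /\ Z v v'].

Definition bisimilar_up_to (p : atom) (G : nseq)
    (M : model) (I : label -> world M)
    (M' : model) (I' : label -> world M') : Prop :=
  exists Z : world M -> world M' -> Prop,
    bisimulation_up_to p Z /\ forall s, has_label G s -> Z (I s) (I' s).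

(* A nested calculus NL for a logic L: derivability in NL, and the class of
   L-models. *)
Record nested_calculus : Type := NestedCalculus {
  derivable : nseq -> Prop;
  logic_model : model -> Prop
}.

Definition ND : nested_calculus := NestedCalculus (NK_with rule_d) D_model.
Definition NT : nested_calculus := NestedCalculus (NK_with rule_t) T_model.

(* The property is semantic: it depends on the calculus only through the
   models of its logic. *)
Definition BNUIP (NL : nested_calculus) : Prop :=
  forall (G : nseq) (p : atom), exists A : mform,
  [/\ (forall q, q \in mform_vars A -> q \in nseq_vars G /\ q <> p) /\
      (forall s, s \in mform_labels A -> has_label G s),
      forall (M : model) (I : label -> world M),
        logic_model NL M -> interpretation G I ->
        mform_sat I A -> nseq_sat I G
    & forall (M : model) (I : label -> world M),
        logic_model NL M -> interpretation G I ->
        ~ mform_sat I A ->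
        exists (M' : model) (I' : label -> world M'),
          [/\ logic_model NL M', interpretation G I',
              bisimilar_up_to p G I' I & ~ nseq_sat I' G]].

(* Main.v *)
(* BNUIP only refers to the models of the logic, so the argument is semantic.
   A type is a set t of subformulas of the sequent G, to be falsified at one
   world.  By recursion on n, "some variant of this world up to p falsifies the
   formulas of t of modal depth at most n" is expressed by a modal formula
   without p, in the style of the cover modality: the literals of t other than
   those on p fail, every successor realizes a type compatible with t, and so
   does a witness for each box of t.  Labelling the nodes of G by compatible
   types falsifying G gives a multiformula, whose negation is A_p(G).
   Conversely, variants realizing the types chosen at the nodes of G are glued
   along the tree of G: adding the root of a variant of I(s*n) as a child of the
   root of a variant of I(s) preserves bisimilarity, since I(s) R I(s*n), and
   falsity of the type at s, by compatibility.  Roots of variants always have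
   proper children, so that for D no reflexive leaf is in the way. *)

From Stdlib Require Import Classical.
From mathcomp Require Import all_boot.
Require Import Defs.

Set Implicit Arguments.
Unset Strict Implicit.
Unset Printing Implicit Defensive.

(** * Negation, finite conjunctions and disjunctions *)

Fixpoint neg (f : form) : form :=
  match f with
  | Bot => Top
  | Top => Bot
  | Pos q => Neg q
  | Neg q => Pos q
  | And g h => Or (neg g) (neg h)
  | Or g h => And (neg g) (neg h)
  | Box g => Dia (neg g)
  | Dia g => Box (neg g)
  end.

Lemma sat_neg (M : model) (f : form) (w : world M) : sat w (neg f) = ~~ sat w f.
Proof.
elim: f w => //= [q w|g IHg h IHh w|g IHg h IHh w|g IHg w|g IHg w].
- by rewrite negbK.
- by rewrite IHg IHh negb_and.
- by rewrite IHg IHh negb_or.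
- rewrite negb_forall; apply: eq_existsb => v.
  by rewrite IHg negb_imply.
- rewrite negb_exists; apply: eq_forallb => v.
  by rewrite IHg negb_and implybE.
Qed.

Lemma form_vars_neg (f : form) : form_vars (neg f) = form_vars f.
Proof. by elim: f => //= [g -> h ->|g -> h ->]. Qed.

Fixpoint mneg (A : mform) : mform :=
  match A with
  | MAt s f => MAt s (neg f)
  | MAnd B C => MOr (mneg B) (mneg C)
  | MOr B C => MAnd (mneg B) (mneg C)
  end.

Lemma mform_sat_mneg (M : model) (I : label -> world M) (A : mform) :
  mform_sat I (mneg A) = ~~ mform_sat I A.
Proof.
elim: A => [s f|B IHB C IHC|B IHB C IHC] /=; first exact: sat_neg.
- by rewrite IHB IHC negb_and.
- by rewrite IHB IHC negb_or.
Qed.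

Lemma mform_vars_mneg (A : mform) : mform_vars (mneg A) = mform_vars A.
Proof. by elim: A => //= [s f|B -> C ->|B -> C ->] //; apply: form_vars_neg. Qed.

Lemma mform_labels_mneg (A : mform) : mform_labels (mneg A) = mform_labels A.
Proof. by elim: A => //= [B -> C ->|B -> C ->]. Qed.

Definition bigAnd (fs : seq form) : form := foldr And Top fs.
Definition bigOr (fs : seq form) : form := foldr Or Bot fs.

Lemma sat_bigAnd (M : model) (w : world M) (fs : seq form) :
  sat w (bigAnd fs) = all (sat w) fs.
Proof. by elim: fs => //= f fs ->. Qed.

Lemma sat_bigOr (M : model) (w : world M) (fs : seq form) :
  sat w (bigOr fs) = has (sat w) fs.
Proof. by elim: fs => //= f fs ->. Qed.

Lemma vars_bigAnd (q : atom) (fs : seq form) :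
  (q \in form_vars (bigAnd fs)) = has (fun f => q \in form_vars f) fs.
Proof. by elim: fs => //= f fs <-; rewrite mem_cat. Qed.

Lemma vars_bigOr (q : atom) (fs : seq form) :
  (q \in form_vars (bigOr fs)) = has (fun f => q \in form_vars f) fs.
Proof. by elim: fs => //= f fs <-; rewrite mem_cat. Qed.

(* A multiformula has at least one label, so the empty conjunction and
   disjunction are placed at a given label s. *)
Definition bigMAnd (s : label) (As : seq mform) : mform := foldr MAnd (MAt s Top) As.
Definition bigMOr (s : label) (As : seq mform) : mform := foldr MOr (MAt s Bot) As.

Section BigMForm.
Variables (s : label) (As : seq mform).

Lemma mform_sat_bigMAnd (M : model) (I : label -> world M) :
  mform_sat I (bigMAnd s As) = all (mform_sat I) As.
Proof. by elim: As => //= A l ->. Qed.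

Lemma mform_sat_bigMOr (M : model) (I : label -> world M) :
  mform_sat I (bigMOr s As) = has (mform_sat I) As.
Proof. by elim: As => //= A l ->. Qed.

Lemma mform_vars_bigMAnd (q : atom) :
  (q \in mform_vars (bigMAnd s As)) = has (fun A => q \in mform_vars A) As.
Proof. by elim: As => //= A l <-; rewrite mem_cat. Qed.

Lemma mform_vars_bigMOr (q : atom) :
  (q \in mform_vars (bigMOr s As)) = has (fun A => q \in mform_vars A) As.
Proof. by elim: As => //= A l <-; rewrite mem_cat. Qed.

Lemma mform_labels_bigMAnd (u : label) :
  (u \in mform_labels (bigMAnd s As)) = has (fun A => u \in mform_labels A) As || (u == s).
Proof. by elim: As => //= [|A l IH]; rewrite ?inE // mem_cat IH orbA. Qed.

Lemma mform_labels_bigMOr (u : label) :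
  (u \in mform_labels (bigMOr s As)) = has (fun A => u \in mform_labels A) As || (u == s).
Proof. by elim: As => //= [|A l IH]; rewrite ?inE // mem_cat IH orbA. Qed.

End BigMForm.

(** * Subformulas and types *)

Fixpoint modal_depth (f : form) : nat :=
  match f with
  | And g h | Or g h => maxn (modal_depth g) (modal_depth h)
  | Box g | Dia g => (modal_depth g).+1
  | _ => 0
  end.

Fixpoint subformulas (f : form) : seq form :=
  f :: match f with
       | And g h | Or g h => subformulas g ++ subformulas h
       | Box g | Dia g => subformulas g
       | _ => [::]
       end.

Lemma mem_subformulas (f : form) : f \in subformulas f.
Proof. by case: f => *; rewrite /= mem_head. Qed.

Definition children_in (Cl : seq form) (f : form) : bool :=
  match f with
  | And g h | Or g h => (g \in Cl) && (h \in Cl)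
  | Box g | Dia g => g \in Cl
  | _ => true
  end.

Definition subformula_closed (Cl : seq form) : Prop :=
  forall f, f \in Cl -> children_in Cl f.

Lemma children_inW (s1 s2 : seq form) (f : form) :
  {subset s1 <= s2} -> children_in s1 f -> children_in s2 f.
Proof.
move=> s12; case: f => //= g h.
- by case/andP=> /s12 -> /s12 ->.
- by case/andP=> /s12 -> /s12 ->.
Qed.

Lemma subformulas_closed (f : form) : subformula_closed (subformulas f).
Proof.
elim: f => [||q|q|g IHg h IHh|g IHg h IHh|g IHg|g IHg] k /=;
  rewrite in_cons => /predU1P[->|] //=; rewrite ?inE ?mem_cat ?mem_subformulas ?orbT //.
- case/orP=> [/IHg|/IHh]; apply: children_inW => x xs;
    by rewrite inE mem_cat xs ?orbT.
- case/orP=> [/IHg|/IHh]; apply: children_inW => x xs;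
    by rewrite inE mem_cat xs ?orbT.
- by move/IHg; apply: children_inW => x xs; rewrite inE xs orbT.
- by move/IHg; apply: children_inW => x xs; rewrite inE xs orbT.
Qed.

Lemma subformulas_vars (f g : form) :
  g \in subformulas f -> {subset form_vars g <= form_vars f}.
Proof.
elim: f g => [||q|q|h IHh k IHk|h IHh k IHk|h IHh|h IHh] g /=;
  rewrite in_cons => /predU1P[->//|] //; rewrite ?mem_cat.
- by case/orP=> [/IHh|/IHk] gs q /gs qs; rewrite mem_cat qs ?orbT.
- by case/orP=> [/IHh|/IHk] gs q /gs qs; rewrite mem_cat qs ?orbT.
- exact: IHh.
- exact: IHh.
Qed.

(** The generated induction principle gives no hypothesis for sequents inside the list of boxes.
    Indexing them with [nth] suits labels, which refer to boxes by position. *)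
Lemma nseq_nested_ind (P : nseq -> Prop) :
  (forall fs bs, (forall i, i < size bs -> P (nth (NSeq [::] [::]) bs i)) ->
    P (NSeq fs bs)) ->
  forall G, P G.
Proof.
move=> IH; fix F 1; case=> fs bs; apply: IH.
elim: bs => [|D bs IHbs] [|i] lti; [discriminate lti | discriminate lti | exact: F | exact: IHbs].
Qed.

Lemma mem_flatten_nth (T : eqType) (U : Type) (F : U -> seq T) (d : U) (s : seq U)
    (i : nat) (x : T) :
  i < size s -> x \in F (nth d s i) -> x \in flatten (map F s).
Proof.
move=> lti xi; apply/flattenP; exists (F (nth d s i)) => //.
by rewrite -(nth_map d [::]) // mem_nth ?size_map.
Qed.

Fixpoint nseq_forms (G : nseq) : seq form :=
  let: NSeq fs bs := G in fs ++ flatten (map nseq_forms bs).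

Lemma nseq_forms_vars (G : nseq) (f : form) (q : atom) :
  f \in nseq_forms G -> q \in form_vars f -> q \in nseq_vars G.
Proof.
elim/nseq_nested_ind: G => fs bs IH /=; rewrite !mem_cat => /orP[fin qf|].
  by apply/orP; left; apply/flattenP; exists (form_vars f) => //; apply: map_f.
case/flattenP=> l /(nthP [::])[i]; rewrite size_map => lti.
rewrite (nth_map (NSeq [::] [::])) // => <- /(IH i lti) H /H qG.
by apply/orP; right; apply: mem_flatten_nth lti qG.
Qed.

Lemma nseq_forms_nth (fs : seq form) (bs : seq nseq) (i : nat) :
  i < size bs ->
  {subset nseq_forms (nth (NSeq [::] [::]) bs i) <= nseq_forms (NSeq fs bs)}.
Proof.
move=> lti f fi; rewrite /= mem_cat; apply/orP; right.
exact: mem_flatten_nth lti fi.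
Qed.

Lemma formulas_sub_nseq_forms (G : nseq) : {subset formulas G <= nseq_forms G}.
Proof. by case: G => fs bs f fin; rewrite /= mem_cat fin. Qed.

Definition closure (G : nseq) : seq form := flatten (map subformulas (nseq_forms G)).

Lemma closure_closed (G : nseq) : subformula_closed (closure G).
Proof.
move=> f /flatten_mapP[g gin fg]; apply: children_inW (subformulas_closed fg).
by move=> h hg; apply/flatten_mapP; exists g.
Qed.

Lemma nseq_forms_closure (G : nseq) : {subset nseq_forms G <= closure G}.
Proof. by move=> f fin; apply/flatten_mapP; exists f => //; apply: mem_subformulas. Qed.

Lemma closure_vars (G : nseq) (f : form) (q : atom) :
  f \in closure G -> q \in form_vars f -> q \in nseq_vars G.
Proof.
case/flatten_mapP=> g gin fg qf; apply: nseq_forms_vars gin _.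
exact: (subformulas_vars fg).
Qed.

(** Plays the role of a powerset: every subset of a closure, taken as a filter of it, occurs here,
    so there are finitely many types to range over in a formula. *)
Fixpoint sublists (T : Type) (s : seq T) : seq (seq T) :=
  if s is x :: s' then sublists s' ++ map (cons x) (sublists s') else [:: [::]].

Lemma filter_sublists (T : eqType) (a : pred T) (s : seq T) :
  filter a s \in sublists s.
Proof.
elim: s => //= x s IH; rewrite mem_cat; case: (a x); last by rewrite IH.
by rewrite (map_f (cons x) IH) orbT.
Qed.

Lemma sublists_sub (T : eqType) (s t : seq T) : t \in sublists s -> {subset t <= s}.
Proof.
elim: s t => [|x s IH] t /=; first by rewrite inE => /eqP->.
rewrite mem_cat => /orP[/IH ts y /ts ys|/mapP[u /IH us ->] y]; first by rewrite inE ys orbT.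
by rewrite !inE => /predU1P[->|/us ->]; rewrite ?eqxx ?orbT.
Qed.

(* A type is the set of subformulas to be falsified at a world.  The flag b
   tells reflexive frames (b = true, the logic T) from serial ones. *)
Definition saturated (b : bool) (t : seq form) : bool :=
  all (fun f => match f with
    | Top => false
    | Pos q => Neg q \notin t
    | And g h => (g \in t) || (h \in t)
    | Or g h => (g \in t) && (h \in t)
    | Dia g => b ==> (g \in t)
    | _ => true
    end) t.

Definition dia_all (a : pred form) (t : seq form) : bool :=
  all (fun f => if f is Dia g then a g else true) t.

Lemma dia_allP (a : pred form) (t : seq form) :
  reflect (forall g, Dia g \in t -> a g) (dia_all a t).
Proof.
apply: (iffP allP) => [H g /H //|H f]; case: f => //= g; exact: H.
Qed.

(** Where a diamond fails, its argument fails at every successor. This is the constraint that a type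
    [t] puts on the type [s] of a successor. *)
Definition compat (t s : seq form) : bool := dia_all (mem s) t.

Section Interpolant.
Variables (b : bool) (p : atom) (Cl : seq form).

Definition types : seq (seq form) := filter (saturated b) (sublists Cl).

(** A literal of a type has to fail, so its complement is required. Literals on [p] impose nothing,
    since a variant chooses the value of [p] freely. *)
Definition avoid (f : form) : form :=
  match f with
  | Pos q => if q == p then Top else Neg q
  | Neg q => if q == p then Top else Pos q
  | _ => Top
  end.

(* The existential p-quantification of "every formula of t of modal depth at
   most n fails". *)
Fixpoint variant_form (n : nat) (t : seq form) : form :=
  And (bigAnd (map avoid t))
    (if n is m.+1 then
       And (Box (bigOr [seq variant_form m s | s <- types & compat t s]))
         (bigAnd [seq if f is Box g
                      then Dia (bigOr [seq variant_form m s |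
                                        s <- types & compat t s && (g \in s)])
                      else Top | f <- t])
     else Top).

Lemma typesP (t : seq form) :
  t \in types -> saturated b t /\ {subset t <= Cl}.
Proof. by rewrite mem_filter => /andP[? /sublists_sub]. Qed.

Lemma variant_form_vars (n : nat) (t : seq form) (q : atom) :
  {subset t <= Cl} -> q \in form_vars (variant_form n t) ->
  q <> p /\ exists2 f, f \in Cl & q \in form_vars f.
Proof.
have lit u : {subset u <= Cl} -> q \in form_vars (bigAnd (map avoid u)) ->
    q <> p /\ exists2 f, f \in Cl & q \in form_vars f.
  move=> uCl; rewrite vars_bigAnd has_map => /hasP[f /uCl fin] /=.
  case: f fin => //= r fin; case: eqP => //= rp; rewrite inE => /eqP->;
    split=> //; eexists; by [exact: fin | rewrite inE].
elim: n t => [|n IH] t tCl /=; rewrite mem_cat => /orP[/(lit _ tCl)//|] //=.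
have big (a : pred (seq form)) :
    q \in form_vars (bigOr [seq variant_form n s | s <- types & a s]) ->
    q <> p /\ exists2 f, f \in Cl & q \in form_vars f.
  rewrite vars_bigOr has_map => /hasP[s]; rewrite mem_filter => /andP[_].
  by case/typesP => _ sCl; apply: IH.
rewrite mem_cat => /orP[/big//|]; rewrite vars_bigAnd has_map => /hasP[f _] /=.
by case: f => //= g /big.
Qed.

End Interpolant.
(** * Frames, trees of copies of worlds, and the models they unfold to *)

(** What the construction uses of the given model, in a form common to both logics. The first clause
    is well-foundedness of proper accessibility, which permits induction from the leaves towards the
    root. *)
Definition frame (b : bool) (M : model) : Prop :=
  [/\ forall P : world M -> Prop,
        (forall w, (forall v, strict (@acc M) w v -> P v) -> P w) -> forall w, P w,
      forall w : world M, exists v, acc w v,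
      b -> reflexive (@acc M)
    & ~~ b -> forall w v : world M, strict (@acc M) w v -> ~~ acc w w].

(* Walks from the root never repeat a vertex, so their length bounds how far
   one can still go down. *)
Lemma directed_tree_ind (T : finType) (e : rel T) (P : T -> Prop) :
  directed_tree e -> (forall x, (forall y, e x y -> P y) -> P x) -> forall x, P x.
Proof.
case=> r tree step x.
have bound s : path e r s -> size s < #|T|.
  move=> ps; have [u [_ uniqu]] := tree (last r s).
  have us : u = s by apply: uniqu.
  case: (shortenP ps) uniqu => v pv uv _ uniqu.
  have {us}<- : v = s by rewrite -us; apply/esym/uniqu.
  by rewrite -[_.+1]/(size (r :: v)) -(card_uniqP uv) max_card.
have [s [[ps lasts] _]] := tree x.
have [k] := ubnP (#|T| - size s).
elim: k x s ps lasts => // k IH x s ps lasts lek; apply: step => y exy.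
have psy : path e r (rcons s y) by rewrite rcons_path ps lasts.
apply: (IH y (rcons s y)) => //; first by rewrite last_rcons.
by rewrite ltnS in lek; apply: leq_trans lek; rewrite ltn_sub2l ?size_rcons // bound.
Qed.

Lemma D_frame (M : model) : D_model M -> frame false M.
Proof. by case=> tree ser irr; split=> // P; apply: directed_tree_ind. Qed.

Lemma T_frame (M : model) : T_model M -> frame true M.
Proof.
case=> tree re; split=> // [P|w]; first exact: directed_tree_ind.
by exists w; apply: re.
Qed.

Section Trees.
Variables (b : bool) (p : atom) (M : model).

(* Node w c ch is a copy of the world w where p has the value c. *)
Inductive tree : Type := Node of world M & bool & seq tree.

Definition tlab (t : tree) : world M := let: Node w _ _ := t in w.
Definition tbit (t : tree) : bool := let: Node _ c _ := t in c.
Definition tchildren (t : tree) : seq tree := let: Node _ _ ch := t in ch.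
(** Reflexivity of the root of [t] in the unfolded model: every node for T, only the leaves for
    D. *)
Definition loop (t : tree) : bool := b || nilp (tchildren t).

Definition tval (t : tree) (q : atom) : bool :=
  if q == p then tbit t else valuation q (tlab t).

(** Truth at the root of the unfolded model, computed from [t] alone. It does not depend on where
    [t] sits in a larger tree, which is what makes gluing possible. *)
Fixpoint tsat (f : form) (t : tree) : bool :=
  match f with
  | Bot => false
  | Top => true
  | Pos q => tval t q
  | Neg q => ~~ tval t q
  | And g h => tsat g t && tsat h t
  | Or g h => tsat g t || tsat h t
  | Box g => (loop t ==> tsat g t) && all (tsat g) (tchildren t)
  | Dia g => (loop t && tsat g t) || has (tsat g) (tchildren t)
  end.

(* The projection to M is a bisimulation up to p. *)
Fixpoint good (t : tree) : bool :=
  let: Node w c ch := t in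
  [&& all (fun d => acc w (tlab d) && good d) ch,
      [forall v, acc w v ==> has (fun d => tlab d == v) ch || ((v == w) && (b || nilp ch))]
    & (b || nilp ch) ==> acc w w].

Fixpoint subtree (t : tree) (s : seq nat) : option tree :=
  if s is i :: s' then
    if i < size (tchildren t) then subtree (nth t (tchildren t) i) s' else None
  else Some t.

Lemma tree_nested_ind (P : tree -> Prop) :
  (forall w c ch, (forall d i, i < size ch -> P (nth d ch i)) -> P (Node w c ch)) ->
  forall t, P t.
Proof.
move=> IH; fix F 1; case=> w c ch; apply: IH => d.
elim: ch => [|e ch IHch] [|i] lti; [discriminate lti | discriminate lti | exact: F | exact: IHch].
Qed.

(** The addresses of all nodes, child indices counted from 0; they supply the finite set of worlds.
    Mapping [positions] over [ch] before selecting an entry keeps the recursion structural. *)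
Fixpoint positions (t : tree) : seq (seq nat) :=
  let: Node _ _ ch := t in
  [::] :: flatten [seq map (cons i) (nth [::] (map positions ch) i) | i <- iota 0 (size ch)].

Lemma mem_positions (t : tree) (s : seq nat) : (s \in positions t) = isSome (subtree t s).
Proof.
elim/tree_nested_ind: t s => w c ch IH [|i s] //=; rewrite inE /=.
case: ltnP => lti.
  rewrite -IH // -(nth_map _ [::]) //.
  apply/flatten_mapP/idP => [[j]|sin].
    by rewrite mem_iota => /andP[_ ltj] /mapP[u uin [-> ->]].
  by exists i; rewrite ?mem_iota //; apply: map_f.
apply/flatten_mapP => -[j]; rewrite mem_iota => /andP[_ ltj] /mapP[u uin [ij _]].
by move: ltj; rewrite -ij add0n ltnNge lti.
Qed.

Lemma subtree_rcons (t : tree) (s : seq nat) (i : nat) :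
  subtree t (rcons s i) =
  if subtree t s is Some d then
    if i < size (tchildren d) then Some (nth d (tchildren d) i) else None
  else None.
Proof.
elim: s t => [|j s IH] t //=; case: ifP => // ltj; exact: IH.
Qed.

Lemma good_subtree (t d : tree) (s : seq nat) : good t -> subtree t s = Some d -> good d.
Proof.
elim: s t => [|i s IH] t /=; first by move=> gt [<-].
case: t => w c ch /= /and3P[/all_nthP gch _ _]; case: ifP => // lti.
by apply: IH; have /andP[] := gch (Node w c ch) i lti.
Qed.

Variable t : tree.

Definition pos : finType := seq_sub (positions t).
Definition at_pos (x : pos) : tree := odflt t (subtree t (val x)).

(** The last entry of the address of [y] is its index among the children. The default 0 is harmless:
    the empty address is no [rcons]. *)
Definition child_pos (x y : pos) : bool := val y == rcons (val x) (last 0 (val y)).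

Definition tmodel : model :=
  Model [rel x y : pos | child_pos x y || ((x == y) && loop (at_pos x))]
        (fun q => [pred x : pos | tval (at_pos x) q]).

Lemma at_posE (x : pos) : subtree t (val x) = Some (at_pos x).
Proof.
rewrite /at_pos; have := valP x; rewrite mem_positions.
by case: (subtree t _).
Qed.

Lemma child_posP (x y : pos) :
  reflect (exists2 i, i < size (tchildren (at_pos x)) &
             val y = rcons (val x) i /\ at_pos y = nth (at_pos x) (tchildren (at_pos x)) i)
          (child_pos x y).
Proof.
apply: (iffP eqP) => [valy|[i _ [-> _]]]; last by rewrite last_rcons.
move: (last _ _) valy => i valy; have := at_posE y.
rewrite valy subtree_rcons at_posE; case: ifP => // lti [aty].
by exists i.
Qed.

Lemma exists_child_pos (x : pos) (i : nat) : i < size (tchildren (at_pos x)) ->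
  exists2 y, child_pos x y & at_pos y = nth (at_pos x) (tchildren (at_pos x)) i.
Proof.
move=> lti.
have yin : rcons (val x) i \in positions t.
  by rewrite mem_positions subtree_rcons at_posE lti.
pose y : pos := SeqSub yin; exists y.
  by rewrite /child_pos /= last_rcons.
by have := at_posE y; rewrite /= subtree_rcons at_posE lti => -[].
Qed.

Lemma child_pos_irr (x : pos) : child_pos x x = false.
Proof.
apply/negP => /eqP /(congr1 size); rewrite size_rcons => /eqP.
by rewrite -[X in X == _]addn0 -addn1 eqn_add2l.
Qed.

Lemma tmodel_sat (f : form) (x : world tmodel) : sat x f = tsat f (at_pos x).
Proof.
elim: f x => //= [g IHg h IHh x|g IHg h IHh x|g IHg x|g IHg x].
- by rewrite IHg IHh.
- by rewrite IHg IHh.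
- apply/forallP/andP => [H|[Hl /(all_nthP (at_pos x)) Hc] y].
    split.
      by apply/implyP => lx; have := H x; rewrite eqxx lx orbT IHg.
    apply/(all_nthP (at_pos x)) => i /exists_child_pos[y xy <-].
    by have := H y; rewrite xy IHg.
  rewrite IHg; apply/implyP => /orP[/child_posP[i lti [_ ->]]|/andP[/eqP<-]].
    exact: Hc.
  by apply/implyP.
- apply/existsP/orP => [[y]|[/andP[lx gx]|/(has_nthP (at_pos x))[i]]].
  + rewrite IHg => /andP[/orP[/child_posP[i lti [_ ->]]|/andP[/eqP<- lx]] gy].
      by right; apply/(has_nthP (at_pos x)); exists i.
    by left; rewrite lx.
  + by exists x; rewrite eqxx lx orbT IHg.
  + by move=> /exists_child_pos[y xy <-] gy; exists y; rewrite xy IHg.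
Qed.

Lemma strict_tmodel (x y : world tmodel) : strict (@acc tmodel) x y = child_pos x y.
Proof.
rewrite /strict /=; case: eqP => [->|_] /=; first by rewrite child_pos_irr.
by rewrite orbF.
Qed.

Lemma child_pos_inj (x y z : pos) : child_pos x z -> child_pos y z -> x = y.
Proof.
by move=> /eqP xz /eqP; rewrite xz => /eqP; rewrite eqseq_rcons => /andP[/eqP/val_inj].
Qed.

(** A walk from the root to [x] is found by removing the last index of its address repeatedly. It is
    unique because a position has at most one parent and the root has none. *)
Lemma tmodel_directed : directed_tree (strict (@acc tmodel)).
Proof.
have rin : [::] \in positions t by rewrite mem_positions.
pose r : pos := SeqSub rin; exists r => x.
have [s s_path] : exists s, path child_pos r s /\ last r s = x.
  have [n] := ubnP (size (val x)); elim: n x => // n IH x.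
  case/lastP Ex: (val x) => [|s i] ltn.
    by exists [::]; split=> //=; apply: val_inj; rewrite Ex.
  have yin : s \in positions t.
    have := valP x; rewrite Ex !mem_positions subtree_rcons.
    by case: (subtree t s).
  have [|u [pu lastu]] := IH (SeqSub yin); first by rewrite size_rcons in ltn.
  exists (rcons u x); rewrite last_rcons rcons_path pu lastu /child_pos /=.
  by split=> //; rewrite Ex last_rcons.
exists s; split.
  by case: s_path => ps ls; split=> //; rewrite (eq_path strict_tmodel).
move=> u []; rewrite (eq_path strict_tmodel) => pu lu.
case: s_path; elim/last_ind: s x u pu lu => [|s y IH] x u.
  case/lastP: u => // u y; rewrite rcons_path last_rcons => /andP[_ uy] <- _ /= ry.
  by move: uy; rewrite -ry /child_pos /= => /eqP /(congr1 size); rewrite size_rcons.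
case/lastP: u => [_ /= <-|u z].
  rewrite rcons_path last_rcons => /andP[_ sy] yr.
  by move: sy; rewrite yr /child_pos /= => /eqP /(congr1 size); rewrite size_rcons.
rewrite !rcons_path !last_rcons => /andP[pu uz] zx /andP[ps sy] yx; subst.
by congr rcons; apply: (IH (last r s)) => //; apply: child_pos_inj uz sy.
Qed.

Lemma tmodel_bisim :
  good t -> bisimulation_up_to p (fun (x : world tmodel) w => tlab (at_pos x) = w).
Proof.
move=> gt; split.
  have rin : [::] \in positions t by rewrite mem_positions.
  by exists (SeqSub rin : pos), (tlab (at_pos (SeqSub rin))).
move=> x _ <-; have := good_subtree gt (at_posE x).
case Ex: (at_pos x) => [w c ch] /= /and3P[/all_nthP gch /forallP gback gloop].
split=> [q qp|y|v].
- by rewrite /= /tval Ex; case: eqP.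
- case/orP=> [/child_posP[i]|/andP[/eqP<-]].
    rewrite Ex /= => lti [_ ->]; eexists; split; last by [].
    by have /andP[] := gch (Node w c ch) i lti.
  by rewrite Ex /loop /= => lx; exists w; rewrite (implyP gloop lx).
- move=> wv; have /orP[/(has_nthP (Node w c ch))[i lti /eqP labv]|/andP[/eqP-> lw]] := implyP (gback v) wv.
    have [|y xy aty] := @exists_child_pos x i; first by rewrite Ex.
    by exists y; rewrite xy aty Ex.
  by exists x; rewrite eqxx Ex /loop /= lw orbT.
Qed.

End Trees.

Lemma D_tmodel (p : atom) (M : model) (t : tree M) : D_model (tmodel false p t).
Proof.
split; first exact: tmodel_directed.
- move=> x; case Ex: (tchildren (at_pos x)) => [|d ch].
    by exists x; rewrite /= eqxx /loop Ex orbT.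
  have [|y xy _] := @exists_child_pos _ _ x 0; first by rewrite Ex.
  by exists y; rewrite /= xy.
(* A proper successor is a child, so [x] is not a leaf and carries no loop. *)
- move=> x y; rewrite strict_tmodel => /child_posP[i lti _] /=.
  rewrite child_pos_irr eqxx /loop /=.
  by case: (tchildren _) lti.
Qed.

Lemma T_tmodel (p : atom) (M : model) (t : tree M) : T_model (tmodel true p t).
Proof.
split; first exact: tmodel_directed.
by move=> x; rewrite /= eqxx orbT.
Qed.

(** * Realizing types by variants *)

Lemma exists_list_of_witnesses (X : eqType) (Y : Type) (l : seq X) (Q : pred Y)
    (R : X -> pred Y) :
  (forall x, x \in l -> exists y, Q y && R x y) ->
  exists ys, all Q ys /\ forall x, x \in l -> has (R x) ys.
Proof.
elim: l => [|x l IH] H; first by exists [::].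
have [y /andP[Qy Rxy]] := H x (mem_head x l).
have [|ys [Qys Rys]] := IH; first by move=> z zl; apply: H; rewrite inE zl orbT.
exists (y :: ys); rewrite /= Qy Qys; split=> // z.
by rewrite inE => /predU1P[->|/Rys ->]; rewrite ?Rxy ?orbT.
Qed.

Section Realization.
Variables (b : bool) (p : atom) (Cl : seq form) (M : model).
Hypothesis frM : frame b M.

Local Notation tree := (tree M).
Local Notation tsat := (@tsat b p M).
Local Notation good := (@good b M).

(** When every successor of [w], possibly [w] itself, has a copy among the children, the back
    condition never relies on a loop. Seriality then makes [ch] nonempty, so a loop occurs only in
    the reflexive case. *)
Lemma good_node (w : world M) (c : bool) (ch : seq tree) :
  all (fun d => acc w (tlab d) && good d) ch ->
  (forall v, acc w v -> has (fun d => tlab d == v) ch) ->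
  good (Node w c ch).
Proof.
have [_ ser refl _] := frM; move=> gch back /=; rewrite gch /=.
apply/andP; split; first by apply/forallP => v; apply/implyP => /back ->.
have [v wv] := ser w; apply/implyP => /orP[/refl->//|].
by have := back v wv; case: ch {gch back}.
Qed.

(** The children are unfoldings of the proper successors only, which keeps the induction
    well-founded. If [w] sees itself, the loop of the node accounts for it: for D, such a world has
    no proper successor and its copy is a leaf. *)
Lemma exists_unfolding (w : world M) : exists2 t : tree, good t & tlab t = w.
Proof.
have [ind ser refl irr] := frM; elim/ind: w => w IH.
have [|ch [gch hch]] := @exists_list_of_witnesses _ _ (enum (strict (@acc M) w))
    (fun d : tree => strict (@acc M) w (tlab d) && good d) (fun v d => tlab d == v).
  move=> v; rewrite mem_enum => wv; have [d gd labd] := IH v wv.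
  rewrite -topredE /= in wv.
  by exists d; rewrite labd wv gd eqxx.
exists (Node w false ch) => //=; apply/and3P; split.
- by apply: sub_all gch => d /andP[/andP[_ ->] ->].
- apply/forallP => v; apply/implyP => wv.
  case: (eqVneq v w) => [vw|neq]; last first.
    by rewrite hch // mem_enum inE /= eq_sym neq.
  rewrite {v}vw in wv *; case: b irr => /= irr'; rewrite ?orbT //.
  case: ch gch {hch} => //= d ch /andP[/andP[wd _] _].
  by have := irr' isT w _ wd; rewrite wv.
- case: b refl => [refl|_] /=; first by rewrite refl.
  apply/implyP; case: ch hch {gch} => //= hch _.
  have [v wv] := ser w; case: (eqVneq w v) => [{2}->//|neq].
  by have := hch v; rewrite mem_enum inE /= neq wv => /(_ isT).
Qed.

(** Giving [p] the value [Neg p \in t] falsifies both literals on [p], as saturation excludes having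
    both in [t]. Since [ch] is nonempty, the root has a loop only for T, and there saturation puts
    the argument of each diamond into [t]. *)
Lemma falsify_type (n : nat) (t : seq form) (w : world M) (ch : seq tree) :
  saturated b t -> all (sat w) (map (avoid p) t) -> ~~ nilp ch ->
  (forall g, Dia g \in t -> modal_depth g < n -> all (fun d => ~~ tsat g d) ch) ->
  (forall g, Box g \in t -> modal_depth g < n -> has (fun d => ~~ tsat g d) ch) ->
  forall f, f \in t -> modal_depth f <= n -> ~~ tsat f (Node w (Neg p \in t) ch).
Proof.
move=> /allP satt; rewrite all_map => /allP lits nech dia box.
elim=> [||q|q|g IHg h IHh|g IHg h IHh|g IHg|g IHg] ft //=.
- by have := satt _ ft.
- rewrite /tval /= => _; have := satt _ ft; have := lits _ ft; rewrite /=.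
  by case: eqP => [->|].
- rewrite /tval /= negbK => _; have := lits _ ft; rewrite /=.
  by case: eqP => [<-|].
- rewrite geq_max negb_and => /andP[dg dh]; have := satt _ ft => /= /orP[gt|ht].
    by rewrite IHg.
  by rewrite IHh ?orbT.
- rewrite geq_max negb_or => /andP[dg dh]; have := satt _ ft => /= /andP[gt ht].
  by rewrite IHg ?IHh.
- move=> dg; rewrite negb_and -has_predC; apply/orP; right; exact: box.
- move=> dg; rewrite negb_or -all_predC; apply/andP; split; last exact: dia.
  rewrite /loop (negPf nech) orbF negb_and -implybE; apply/implyP => bT.
  apply: IHg (ltnW dg); have := satt _ ft => /=; by rewrite bT.
Qed.

(* The prescribed trees xs become the first children of the variant; this is
   what allows variants to be glued along a nested sequent. *)
Lemma variant_form_realized (n : nat) (t : seq form) (w : world M) (xs : seq tree) :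
  saturated b t -> sat w (variant_form b p Cl n t) ->
  all (fun d => [&& acc w (tlab d), good d & dia_all (fun g => ~~ tsat g d) t]) xs ->
  exists ch, good (Node w (Neg p \in t) (xs ++ ch)) /\
    forall f, f \in t -> modal_depth f <= n -> ~~ tsat f (Node w (Neg p \in t) (xs ++ ch)).
Proof.
have [_ ser _ _] := frM.
have nonempty (u : world M) (ys zs : seq tree) :
    (forall v, v \in enum (acc u) -> has (fun d => tlab d == v) zs) -> ~~ nilp (ys ++ zs).
  move=> H; have [v uv] := ser u; have := H v; rewrite mem_enum => /(_ uv).
  by move=> {H}; case: zs => // z zs _; rewrite /nilp size_cat addnS.
elim: n t w xs => [|n IH] t w xs satt; rewrite [sat _ _]/= sat_bigAnd.
  rewrite andbT => lits okxs.
  (* At depth 0 no modal formula has to fail, so arbitrary unfoldings of the successors of [w] serve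
     as the remaining children. *)
  have [|ch [gch hch]] := @exists_list_of_witnesses _ _ (enum (acc w))
      (fun d : tree => acc w (tlab d) && good d) (fun v d => tlab d == v).
    move=> v; rewrite mem_enum => wv; have [d gd labd] := exists_unfolding v.
    by exists d; rewrite labd gd eqxx !andbT.
  exists ch; split; last by apply: falsify_type => //; exact: nonempty hch.
  apply: good_node => [|v wv]; rewrite ?all_cat ?has_cat.
    by rewrite gch andbT; apply: sub_all okxs => d /and3P[-> ->].
  by rewrite hch ?orbT // mem_enum.
rewrite sat_bigAnd => /and3P[lits /forallP boxs]; rewrite all_map => /allP dias okxs.
pose Q (d : tree) := [&& acc w (tlab d), good d &
  dia_all (fun g => (modal_depth g <= n) ==> ~~ tsat g d) t].
have realize s v : s \in types b Cl -> compat t s -> acc w v ->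
    sat v (variant_form b p Cl n s) ->
    exists d, [&& Q d, tlab d == v & all (fun f => (modal_depth f <= n) ==> ~~ tsat f d) s].
  move=> /typesP[sats _] /dia_allP ts wv sv.
  have [ch [gd fd]] := IH s v [::] sats sv isT.
  exists (Node v (Neg p \in s) ch); rewrite /Q /tlab wv gd eqxx /=.
  apply/andP; split; last by apply/allP => f fs; apply/implyP; apply: fd.
  by apply/dia_allP => g /ts gs; apply/implyP; apply: fd.
(* [ch1] copies every successor, for the back condition; [ch2] below refutes the boxes of [t]. *)
have [|ch1 [Q1 h1]] := @exists_list_of_witnesses _ _ (enum (acc w)) Q (fun v d => tlab d == v).
  move=> v; rewrite mem_enum => wv; have := implyP (boxs v) wv.
  rewrite sat_bigOr has_map => /hasP[s]; rewrite mem_filter => /andP[ts sT] sv.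
  by have [d /and3P[Qd ld _]] := realize s v sT ts wv sv; exists d; rewrite Qd.
(* Formulas of [t] that are not boxes need no witness; [d0] fills their places in [ch2]. *)
have [d0 Qd0] : exists d, Q d.
  have [v wv] := ser w; have := h1 v; rewrite mem_enum => /(_ wv).
  move=> /(has_nthP (Node v true [::]))[i lti _]; exists (nth (Node v true [::]) ch1 i).
  by move/all_nthP: Q1; apply.
have [|ch2 [Q2 h2]] := @exists_list_of_witnesses _ _ t Q
    (fun f d => if f is Box g then (modal_depth g <= n) ==> ~~ tsat g d else true).
  move=> f ft; have := dias f ft; case: f ft => /= [||q|q|g h|g h|g|g] ft;
    try by move=> _; exists d0; rewrite Qd0.
  case/existsP=> v /andP[wv]; rewrite sat_bigOr has_map => /hasP[s].
  rewrite mem_filter => /andP[/andP[ts gs] sT] sv.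
  have [d /and3P[Qd _ /allP fd]] := realize s v sT ts wv sv.
  by exists d; rewrite Qd fd.
have Qall : all Q (xs ++ ch2 ++ ch1).
  rewrite !all_cat Q1 Q2 !andbT; apply: sub_all okxs => d /and3P[wd gd /dia_allP dd].
  by rewrite /Q wd gd; apply/dia_allP => g /dd ->; rewrite implybT.
exists (ch2 ++ ch1); split.
  apply: good_node => [|v wv]; last by rewrite !has_cat h1 ?orbT // mem_enum.
  by apply: sub_all Qall => d /and3P[-> ->].
apply: falsify_type => //.
- by rewrite catA; apply: nonempty h1.
- move=> g gt dg; apply: sub_all Qall => d /and3P[_ _ /dia_allP /(_ g gt)].
  by move/implyP; apply.
- move=> g gt dg; rewrite has_cat; apply/orP; right; rewrite has_cat; apply/orP; left.
  by apply: sub_has (h2 _ gt) => d /= /implyP; apply.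
Qed.

Definition type_of (w : world M) : seq form := [seq f <- Cl | ~~ sat w f].

Hypothesis Cl_closed : subformula_closed Cl.

Lemma type_of_types (w : world M) : type_of w \in types b Cl.
Proof.
have [_ _ refl _] := frM; rewrite mem_filter filter_sublists andbT.
apply/allP => f; rewrite mem_filter => /andP[]; case: f => //= [q|g h|g h|g].
- by move=> nq _; rewrite mem_filter /= nq.
- move=> gh /Cl_closed /= /andP[gC hC]; rewrite !mem_filter gC hC !andbT.
  by rewrite -negb_and.
- move=> gh /Cl_closed /= /andP[gC hC]; rewrite !mem_filter gC hC !andbT.
  by rewrite -negb_or.
- move=> ng /Cl_closed /= gC; apply/implyP => bT; rewrite mem_filter gC andbT.
  by apply: contra ng => gw; apply/existsP; exists w; rewrite refl.
Qed.

Lemma type_of_compat (w v : world M) : acc w v -> compat (type_of w) (type_of v).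
Proof.
move=> wv; apply/dia_allP => g /=; rewrite !mem_filter /= => /andP[ng /Cl_closed /= ->].
rewrite andbT; apply: contra ng => gv; apply/existsP; exists v; by rewrite wv.
Qed.

(** Every world is a variant of itself: the types of its successors are compatible with its own and
    witness all the disjunctions. *)
Lemma sat_variant_form_type_of (n : nat) (w : world M) :
  sat w (variant_form b p Cl n (type_of w)).
Proof.
have lits v : all (sat v) (map (avoid p) (type_of v)).
  rewrite all_map; apply/allP => f; rewrite mem_filter => /andP[nf _].
  case: f nf => //= q; case: eqP => //= _.
  by rewrite negbK.
elim: n w => [|n IH] w /=; rewrite sat_bigAnd lits //=.
apply/andP; split.
  apply/forallP => v; apply/implyP => wv; rewrite sat_bigOr has_map; apply/hasP.
  exists (type_of v); last exact: IH.
  by rewrite mem_filter type_of_compat ?type_of_types.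
rewrite sat_bigAnd all_map; apply/allP => f; rewrite mem_filter => /andP[nf fC].
case: f nf fC => //= g; rewrite negb_forall => /existsP[v]; rewrite negb_imply.
case/andP=> wv ng /Cl_closed /= gC; apply/existsP; exists v; rewrite wv /=.
rewrite sat_bigOr has_map; apply/hasP; exists (type_of v); last exact: IH.
by rewrite mem_filter type_of_compat ?type_of_types //= mem_filter ng gC.
Qed.

End Realization.

(** * Multiformula interpolants of nested sequents *)

Definition nseq0 : nseq := NSeq [::] [::].

Section Sequents.
Variables (b : bool) (p : atom) (Cl : seq form) (N : nat).

(** For [G] at label [u] with type [t] chosen there, each box gets a disjunction over the compatible
    types that contain its formulas. The default of [nth] is never reached, as [i] stays below
    [size bs]. *)
Fixpoint variant_mform (G : nseq) (u : label) (t : seq form) : mform :=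
  let: NSeq _ bs := G in
  MAnd (MAt u (variant_form b p Cl N t))
    (bigMAnd u [seq bigMOr u
        [seq nth (fun v _ => MAt v Top) (map variant_mform bs) i (rcons u i.+1) s |
          s <- types b Cl & compat t s && all (mem s) (formulas (nth nseq0 bs i))]
      | i <- iota 0 (size bs)]).

Lemma sat_variant_mform (M : model) (I : label -> world M) fs bs u t :
  mform_sat I (variant_mform (NSeq fs bs) u t) <->
  sat (I u) (variant_form b p Cl N t) /\
  forall i, i < size bs -> exists2 s,
    [/\ s \in types b Cl, compat t s & {subset formulas (nth nseq0 bs i) <= s}]
    & mform_sat I (variant_mform (nth nseq0 bs i) (rcons u i.+1) s).
Proof.
rewrite /= mform_sat_bigMAnd all_map; split.
  case/andP=> -> /allP H; split=> // i lti.
  have := H i; rewrite mem_iota lti /= mform_sat_bigMOr has_map => /(_ isT) /hasP[s].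
  rewrite mem_filter => /andP[/andP[ts /allP fs_s] sT] /=.
  by rewrite (nth_map nseq0) // => ss; exists s.
case=> -> H /=; apply/allP => i; rewrite mem_iota => /andP[_ lti] /=.
have [s [sT ts /allP fs_s] ss] := H i lti.
rewrite mform_sat_bigMOr has_map; apply/hasP; exists s; first by rewrite mem_filter ts fs_s.
by rewrite /= (nth_map nseq0).
Qed.

Lemma variant_mform_vars (G : nseq) (u : label) (t : seq form) (q : atom) :
  {subset t <= Cl} -> q \in mform_vars (variant_mform G u t) ->
  q <> p /\ exists2 f, f \in Cl & q \in form_vars f.
Proof.
elim/nseq_nested_ind: G u t => fs bs IH u t tCl /=.
rewrite mem_cat => /orP[/variant_form_vars|]; first by apply.
rewrite mform_vars_bigMAnd has_map => /hasP[i]; rewrite mem_iota => /andP[_ lti] /=.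
rewrite mform_vars_bigMOr has_map => /hasP[s]; rewrite mem_filter => /andP[_].
by case/typesP=> _ sCl /=; rewrite (nth_map nseq0) //; apply: IH.
Qed.

Lemma onth_nth (T : Type) (d : T) (l : seq T) (i : nat) :
  onth l i = if i < size l then Some (nth d l i) else None.
Proof. by elim: l i => [|x l IH] [|i] //=; rewrite IH. Qed.

Lemma variant_mform_labels (G : nseq) (u : label) (t : seq form) (v : label) :
  v \in mform_labels (variant_mform G u t) ->
  exists2 s, v = u ++ s & isSome (sub_at G s).
Proof.
elim/nseq_nested_ind: G u t => fs bs IH u t /=.
have root : exists2 s, u = u ++ s & isSome (sub_at (NSeq fs bs) s).
  by exists [::]; rewrite ?cats0.
rewrite inE => /predU1P[->//|]; rewrite mform_labels_bigMAnd => /orP[|/eqP->//].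
rewrite has_map => /hasP[i]; rewrite mem_iota => /andP[_ lti] /=.
rewrite mform_labels_bigMOr => /orP[|/eqP->//]; rewrite has_map => /hasP[s _] /=.
rewrite (nth_map nseq0) // => /(IH i lti)[w -> Hw]; exists (i.+1 :: w).
  by rewrite cat_rcons.
by rewrite /= (onth_nth nseq0) lti.
Qed.

Section Semantics.
Variables (M : model) (I : label -> world M).
Hypotheses (frM : frame b M) (Cl_closed : subformula_closed Cl).
Hypothesis Cl_depth : forall f, f \in Cl -> modal_depth f <= N.

(** The interpretation condition for a part [D] of a sequent located at [u], with addresses relative
    to [u], as recursion through boxes requires. *)
Definition interprets_at (D : nseq) (u : label) : Prop :=
  forall s n, isSome (sub_at D (rcons s n)) -> acc (I (u ++ s)) (I (rcons (u ++ s) n)).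

Lemma interprets_at_box fs bs i u :
  i < size bs -> interprets_at (NSeq fs bs) u ->
  acc (I u) (I (rcons u i.+1)) /\ interprets_at (nth nseq0 bs i) (rcons u i.+1).
Proof.
move=> lti H; split=> [|s n Hs].
  by have := H [::] i.+1; rewrite /= (onth_nth nseq0) lti cats0; apply.
by have := H (i.+1 :: s) n; rewrite /= (onth_nth nseq0) lti -cat_rcons; apply.
Qed.

(** If [I] itself falsifies [G], each node can be labelled by the type of its own world. *)
Lemma variant_mform_complete (G : nseq) (u : label) :
  {subset nseq_forms G <= Cl} -> interprets_at G u ->
  (forall s D f, sub_at G s = Some D -> f \in formulas D -> ~~ sat (I (u ++ s)) f) ->
  mform_sat I (variant_mform G u (type_of Cl (I u))).
Proof.
elim/nseq_nested_ind: G u => fs bs IH u GCl intG falseG.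
apply/sat_variant_mform; split; first exact: sat_variant_form_type_of.
move=> i lti; have [acci inti] := interprets_at_box lti intG.
have GiCl f : f \in nseq_forms (nth nseq0 bs i) -> f \in Cl.
  by move=> fi; apply: GCl; apply: nseq_forms_nth lti _ fi.
have falsei s D f : sub_at (nth nseq0 bs i) s = Some D -> f \in formulas D ->
    ~~ sat (I (rcons u i.+1 ++ s)) f.
  by move=> Hs; rewrite cat_rcons; apply: falseG; rewrite /= (onth_nth nseq0) lti.
exists (type_of Cl (I (rcons u i.+1))); last exact: IH.
split; [exact: type_of_types | exact: type_of_compat | move=> f fi].
rewrite mem_filter GiCl ?formulas_sub_nseq_forms // andbT.
by rewrite -[rcons _ _]cats0; apply: falsei fi.
Qed.

(** The gluing step: trees realizing the boxes are prescribed as first children of a variant of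
    [I u], and compatibility keeps the diamonds of [t] false. Labels count boxes from 1 and
    addresses count children from 0, hence [predn]. *)
Lemma variant_mform_realized (G : nseq) (u : label) (t : seq form) :
  interprets_at G u -> t \in types b Cl -> {subset formulas G <= t} ->
  mform_sat I (variant_mform G u t) ->
  exists T : tree M,
    [/\ good b T, tlab T = I u, forall f, f \in t -> ~~ tsat b p f T
      & forall s D, sub_at G s = Some D -> exists T',
          [/\ subtree T (map predn s) = Some T', tlab T' = I (u ++ s)
            & forall f, f \in formulas D -> ~~ tsat b p f T']].
Proof.
elim/nseq_nested_ind: G u t => fs bs IH u t intG tT fs_t.
have [satt tCl] := typesP tT.
case/sat_variant_mform=> root sub.
pose R i (T : tree M) := [/\ [&& acc (I u) (tlab T), good b T &
      dia_all (fun g => ~~ tsat b p g T) t], tlab T = I (rcons u i.+1)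
    & forall s D, sub_at (nth nseq0 bs i) s = Some D -> exists T',
        [/\ subtree T (map predn s) = Some T', tlab T' = I (rcons u i.+1 ++ s)
          & forall f, f \in formulas D -> ~~ tsat b p f T']].
have exR i : i < size bs -> exists T, R i T.
  move=> lti; have [acci inti] := interprets_at_box lti intG.
  have [s [sT /dia_allP ts fs_s] ss] := sub i lti.
  have [T [gT lT fT subT]] := IH i lti _ s inti sT fs_s ss.
  exists T; split=> //; rewrite lT acci gT /=.
  by apply/dia_allP => g /ts; apply: fT.
have [xs [size_xs Rxs]] : exists xs : seq (tree M), size xs = size bs /\
    forall d i, i < size bs -> R i (nth d xs i).
  (* The chosen trees are listed in the order of the boxes, so that box [i] becomes child [i]. *)
  elim: {-2}(size bs) (leqnn (size bs)) => [|n IHn] ltn; first by exists [::].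
  have [xs [size_xs Rxs]] := IHn (ltnW ltn); have [T RT] := exR n ltn.
  exists (rcons xs T); rewrite size_rcons size_xs; split=> // d i.
  rewrite nth_rcons size_xs ltnS leq_eqVlt.
  by case: (ltngtP i n) => //= [ltin _|-> _] //; apply: Rxs.
have okxs : all (fun d => [&& acc (I u) (tlab d), good b d &
    dia_all (fun g => ~~ tsat b p g d) t]) xs.
  apply/(all_nthP (Node (I u) true [::])) => i; rewrite size_xs => lti.
  by case: (Rxs (Node (I u) true [::]) i lti).
have [ch [gT fT]] := variant_form_realized frM satt root okxs.
have {}fT f : f \in t -> ~~ tsat b p f (Node (I u) (Neg p \in t) (xs ++ ch)).
  by move=> ft; apply: fT => //; apply/Cl_depth/tCl.
exists (Node (I u) (Neg p \in t) (xs ++ ch)); split=> // -[|[|i] s] D //=.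
  by move=> [<-]; eexists; split; [by [] | by rewrite cats0 | move=> f /fs_t; apply: fT].
rewrite (onth_nth nseq0); case: ifP => // lti; rewrite size_cat nth_cat size_xs lti ltn_addr //.
by case: (Rxs (Node (I u) (Neg p \in t) (xs ++ ch)) i lti) => _ _ H /H; rewrite cat_rcons.
Qed.

End Semantics.

End Sequents.

Lemma BNUIP_of_frame (b : bool) (L : nested_calculus) :
  (forall M, logic_model L M -> frame b M) ->
  (forall p M (T : tree M), logic_model L (tmodel b p T)) ->
  BNUIP L.
Proof.
move=> frL treeL G p.
pose Cl := closure G; pose N := \max_(f <- Cl) modal_depth f.
have ClC : subformula_closed Cl := @closure_closed G.
have ClN f : f \in Cl -> modal_depth f <= N by move=> fC; apply: leq_bigmax_seq.
pose root_types := [seq t <- types b Cl | all (mem t) (formulas G)].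
(* [E] says that some variant up to [p] falsifies [G]; the interpolant is its negation. *)
pose E := bigMOr [:: 1] [seq variant_mform b p Cl N G [:: 1] t | t <- root_types].
have intG M (I : label -> world M) : interpretation G I -> interprets_at I G [:: 1].
  move=> int s n Hs; apply: (int (1 :: s) n) => //.
  rewrite /has_label /=; elim: s (G) Hs => [|[|i] s IHs] D //=.
  by case: (onth _ _) => // D'; apply: IHs.
exists (mneg E); split.
- split=> [q|u].
    rewrite mform_vars_mneg mform_vars_bigMOr has_map => /hasP[t].
    rewrite !mem_filter => /and3P[_ satt /sublists_sub tCl] /=.
    by case/(variant_mform_vars tCl) => qp [f fC qf]; split=> //; apply: closure_vars fC qf.
  rewrite mform_labels_mneg mform_labels_bigMOr => /orP[|/eqP->//].
  by rewrite has_map => /hasP[t _] /= /variant_mform_labels[s ->].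
- move=> M I /frL frM /intG int; rewrite mform_sat_mneg => /negP notE.
  apply: NNPP => notG; apply: notE.
  have falseG s D f : sub_at G s = Some D -> f \in formulas D -> ~~ sat (I ([:: 1] ++ s)) f.
    move=> Hs fD; apply/negP => fI; apply: notG; exists (1 :: s), f.
    by rewrite /occurs /= Hs.
  rewrite mform_sat_bigMOr has_map; apply/hasP; exists (type_of Cl (I [:: 1])); last first.
    by apply: variant_mform_complete => //; apply: nseq_forms_closure.
  rewrite mem_filter type_of_types // andbT; apply/allP => f fG.
  rewrite /= mem_filter nseq_forms_closure ?formulas_sub_nseq_forms // andbT.
  by apply: (falseG [::] G).
- move=> M I /frL frM int; rewrite mform_sat_mneg => /negP; rewrite negbK.
  rewrite mform_sat_bigMOr has_map => /hasP[t]; rewrite mem_filter => /andP[/allP Gt tT] /=.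
  case/(variant_mform_realized frM ClN (intG _ _ int) tT Gt) => T [gT _ _ subT].
  (* The root position, a default value for labels whose address lies outside the tree; labels of
     [G] never need it. *)
  pose T0 : pos T := insubd (SeqSub (etrans (mem_positions T [::]) erefl)) [::].
  (* Dropping the leading 1 and shifting the indices turns a label into an address. *)
  pose I' (u : label) : world (tmodel b p T) := insubd T0 (map predn (behead u)).
  have atI' s D : sub_at G s = Some D ->
      [/\ val (I' (1 :: s)) = map predn s, tlab (at_pos (I' (1 :: s))) = I (1 :: s)
        & forall f, f \in formulas D -> ~~ tsat b p f (at_pos (I' (1 :: s)))].
    move=> Hs; have [T' [Hs' lT' fT']] := subT s D Hs.
    have val' : val (I' (1 :: s)) = map predn s.
      by rewrite val_insubd mem_positions /= Hs'.
    have at' : at_pos (I' (1 :: s)) = T' by rewrite /at_pos val' Hs'.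
    by rewrite val' at'.
  have labelP u : has_label G u -> exists s D, u = 1 :: s /\ sub_at G s = Some D.
    case: u => [|[|[|i]] s] //; rewrite /has_label /=.
    by case Hs: (sub_at G s) => [D|] // _; exists s, D.
  exists (tmodel b p T), I'; split=> //.
  + move=> u n /labelP[s' [D' [us' Hs']]] /labelP[s [D [us Hs]]]; subst u.
    move: us'; rewrite rcons_cons => -[us']; subst s'.
    have [val1 _ _] := atI' _ _ Hs; have [val2 _ _] := atI' _ _ Hs'.
    apply/orP; left; rewrite /child_pos val1 val2 map_rcons last_rcons.
    exact: eqxx.
  + exists (fun x w => tlab (at_pos x) = w); split; first exact: tmodel_bisim.
    by move=> u /labelP[s [D [-> Hs]]]; case: (atI' _ _ Hs).
  + case=> u [f [fu]]; have : has_label G u by move: fu; rewrite /occurs /has_label; case: node_at.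
    move=> /labelP[s [D [us Hs]]]; subst u; rewrite tmodel_sat.
    move: fu; rewrite /occurs /= Hs => fD.
    by case: (atI' _ _ Hs) => _ _ /(_ f fD) /negP.
Qed.

Theorem theorem5 : BNUIP ND /\ BNUIP NT.
Proof.
split.
- exact: (@BNUIP_of_frame false ND D_frame D_tmodel).
- exact: (@BNUIP_of_frame true NT T_frame T_tmodel).
Qed.
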